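(* Let $X=(X,d_X,\mu_X)$ and $Y=(Y,d_Y,\mu_Y)$ be mm-spaces such that $\mu_X$ has full support. Then $$\widehat{d}_{\mathrm{srGW},\infty}(X,Y)=\widehat{d}_{\mathrm{srGH}}(X,Y)=d_{\mathrm{mGH}}(X,Y).$$ Moreover, when $p=\infty$, $\widehat{d}_{\mathrm{srGW},p}$ defines a metric on the space of isometry classes of compact metric spaces which is topologically equivalent to the Gromov-Hausdorff distance on any Gromov-Hausdorff precompact family of compact metric spaces; but $\widehat{d}_{\mathrm{srGW},p}$ does not define a pseudometric for $p<\infty$.
   Context: An mm-space $(X,d_X,\mu_X)$ is a complete separable metric space $(X,d_X)$ with a Borel probability measure $\mu_X$ on $X$. Throughout $p\in[1,\infty]$. Semi-relaxed Gromov-Wasserstein: a semi-coupling of $\mu_X$ and $Y$ is a Borel probability measure $\gamma$ on $X\times Y$ with first marginal $\mu_X$; the set of these is $\mathcal{SC}(\mu_X,Y)$. For $p\in[1,\infty)$, $$\mathrm{dis}_p(\gamma)=\frac12\left(\iint |d_X(x,x')-d_Y(y,y')|^p\,d\gamma(x,y)\,d\gamma(x',y')\right)^{1/p},$$ and $$\mathrm{dis}_\infty(\gamma)=\frac12\sup_{(x,y),(x',y')\in\mathrm{supp}(\gamma)}|d_X(x,x')-d_Y(y,y')|.$$ Set $d_{\mathrm{srGW},p}(X,Y)=\inf_{\gamma\in\mathcal{SC}(\mu_X,Y)}\mathrm{dis}_p(\gamma)$ and $\widehat{d}_{\mathrm{srGW},p}(X,Y)=\max\{d_{\mathrm{srGW},p}(X,Y),d_{\mathrm{srGW},p}(Y,X)\}$.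 Semi-relaxed Gromov-Hausdorff (for the underlying metric spaces): a semi-correspondence is a relation $R\subset X\times Y$ whose coordinate projection to $X$ is onto $X$; $\mathcal{SR}(X,Y)$ is the set of these. With $\mathrm{dis}(R)=\frac12\sup_{(x,y),(x',y')\in R}|d_X(x,x')-d_Y(y,y')|$, set $d_{\mathrm{srGH}}(X,Y)=\inf_{R\in\mathcal{SR}(X,Y)}\mathrm{dis}(R)$ and $\widehat{d}_{\mathrm{srGH}}(X,Y)=\max\{d_{\mathrm{srGH}}(X,Y),d_{\mathrm{srGH}}(Y,X)\}$. Modified Gromov-Hausdorff (for the underlying metric spaces): for an arbitrary (not necessarily continuous) function $f:X\to Y$ let $\mathrm{dis}(f)=\frac12\sup_{x,x'\in X}|d_X(x,x')-d_Y(f(x),f(x'))|$, and similarly for $g:Y\to X$; then $d_{\mathrm{mGH}}(X,Y)=\max\{\inf_{f:X\to Y}\mathrm{dis}(f),\inf_{g:Y\to X}\mathrm{dis}(g)\}$, the infima being over all functions. Gromov-Hausdorff distance: $d_{\mathrm{GH}}(X,Y)=\inf_R\mathrm{dis}(R)$ over all correspondences $R\subset X\times Y$, i.e. relations whose projections to $X$ and to $Y$ are both onto. A family of compact metric spaces is Gromov-Hausdorff precompact if it is precompact with respect to $d_{\mathrm{GH}}$.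
   Formalization: The first equality of hat distances is proved when μ_Y also has full support (false otherwise: X a point, Y two points, μ_Y a Dirac mass); with only μ_X fully supported, d_srGW,∞(X,Y) = d_srGH(X,Y) is proved instead. *)

(* Defs.v *)
From HB Require Import structures.
From mathcomp Require Import all_boot all_order all_algebra.
From mathcomp Require Import all_classical all_reals all_analysis.
Set Implicit Arguments.
Unset Strict Implicit.
Unset Printing Implicit Defensive.
Import Order.TTheory GRing.Theory Num.Theory.
Local Open Scope classical_set_scope.
Local Open Scope ring_scope.

(* Spaces are nonempty, as the carrier of a probability measure must be. The
   base point has no further role; in particular isometries ignore it. *)
#[short(type="pMetricType")]
HB.structure Definition PointedMetric (R : numDomainType) :=
  { T of Pointed T & Metric R T }.

(* A pointed topology on products, with the library's product topology. *)
HB.instance Definition _ (T U : ptopologicalType) :=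
  Topological.on (T * U)%type.

Definition borelType (T : ptopologicalType) := g_sigma_algebraType (@open T).

Record mmSpace (R : realType) := MMSpace {
  mm_space :> pMetricType R ;
  mm_complete : forall F : set_system mm_space,
    ProperFilter F -> cauchy F -> cvg F ;
  mm_separable : exists2 A : set mm_space, countable A & dense A ;
  mm_measure : probability (borelType mm_space) R }.

Section Distances.
Context {R : realType}.
Implicit Types p : \bar R.

Definition msupport (T : ptopologicalType) (mu : probability (borelType T) R)
    : set T :=
  [set x | forall U : set T, open U -> U x -> (0 < mu U)%E].

Definition full_support (X : mmSpace R) := msupport (mm_measure X) = setT.

Section Distortion.
Variables X Y : pMetricType R.

Definition discrepancy (z z' : X * Y) : R :=
  `|mdist z.1 z'.1 - mdist z.2 z'.2|.

Definition rel_distortion (S : set (X * Y)) : \bar R :=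
  ((2^-1)%:E *
   ereal_sup [set (discrepancy zz.1 zz.2)%:E | zz in S `*` S])%E.

Definition fun_distortion (f : X -> Y) : \bar R :=
  ((2^-1)%:E *
   ereal_sup [set `|mdist xx.1 xx.2 - mdist (f xx.1) (f xx.2)|%:E
             | xx in [set: X * X]])%E.

(* Only exponents 1 <= p <= +oo are meaningful. *)
Definition measure_distortion p
    (gamma : probability (borelType (X * Y)%type) R) : \bar R :=
  match p with
  | r%:E => ((2^-1)%:E *
      (\int[gamma]_z \int[gamma]_z' ((discrepancy z z') `^ r)%:E) `^ r^-1)%E
  | +oo%E => rel_distortion (msupport gamma)
  | -oo%E => 0%E
  end.

Definition semi_coupling (mu : probability (borelType X) R)
    (gamma : probability (borelType (X * Y)%type) R) :=
  forall A : set X, measurable (A : set (borelType X)) ->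
    gamma (A `*` [set: Y]) = mu A.

Definition semi_correspondence (S : set (X * Y)) := fst @` S = setT.

Definition correspondence (S : set (X * Y)) :=
  fst @` S = setT /\ snd @` S = setT.

Definition isometric :=
  exists2 f : X -> Y, bijective f & forall x x', mdist (f x) (f x') = mdist x x'.

End Distortion.

Definition d_srGW p (X Y : mmSpace R) : \bar R :=
  ereal_inf [set measure_distortion p gamma
            | gamma in @semi_coupling X Y (mm_measure X)].

Definition hd_srGW p (X Y : mmSpace R) : \bar R :=
  Order.max (d_srGW p X Y) (d_srGW p Y X).

Definition d_srGH (X Y : pMetricType R) : \bar R :=
  ereal_inf [set rel_distortion S | S in @semi_correspondence X Y].

Definition hd_srGH (X Y : pMetricType R) : \bar R :=
  Order.max (d_srGH X Y) (d_srGH Y X).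

Definition d_mGH (X Y : pMetricType R) : \bar R :=
  Order.max (ereal_inf (range (@fun_distortion X Y)))
            (ereal_inf (range (@fun_distortion Y X))).

Definition d_GH (X Y : pMetricType R) : \bar R :=
  ereal_inf [set rel_distortion S | S in @correspondence X Y].

Record isoClass := IsoClass {
  iso_class : set (pMetricType R) ;
  iso_classP : exists2 K : pMetricType R,
    compact [set: K] & iso_class = [set L | isometric K L] }.

(* [d_GH] depends only on the isometry classes of its arguments; the infimum
   merely selects this common value. *)
Definition d_GH_class (C C' : isoClass) : \bar R :=
  ereal_inf [set d_GH KL.1 KL.2 | KL in iso_class C `*` iso_class C'].

End Distances.

Arguments isoClass : clear implicits.

Section DistanceFunctions.
Context {R : realType} {T : Type}.
Implicit Types (d : T -> T -> \bar R) (F U : set T).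

(* The value +oo is allowed, so only the axioms proper can fail. *)
Definition is_pseudometric F d :=
  [/\ forall x y, F x -> F y -> (0 <= d x y)%E,
      forall x, F x -> d x x = 0%E,
      forall x y, F x -> F y -> d x y = d y x &
      forall x y z, F x -> F y -> F z -> (d x z <= d x y + d y z)%E].

Definition is_metric d :=
  [/\ is_pseudometric setT d,
      forall x y, d x y \is a fin_num &
      forall x y, d x y = 0%E -> x = y].

(* Relative sequential compactness: the limit need not belong to F. *)
Definition precompact_family d F :=
  forall u : nat -> T, (forall n, F (u n)) ->
  exists (phi : nat -> nat) (l : T),
    {homo phi : m n / (m < n)%N} /\ d (u (phi n)) l @[n --> \oo] --> 0%E.

Definition open_in d F U :=
  U `<=` F /\
  forall x, U x -> exists2 e : R, 0 < e &
    forall y, F y -> (d x y < e%:E)%E -> U y.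

Definition topologically_equivalent_on F d d' :=
  forall U, open_in d F U <-> open_in d' F U.

End DistanceFunctions.

(* Main.v *)
Require Import Defs.
From HB Require Import structures.
From mathcomp Require Import all_boot all_order all_algebra.
From mathcomp Require Import all_classical all_reals all_analysis.
From mathcomp Require Import finmap lra.
Set Implicit Arguments.
Unset Strict Implicit.
Unset Printing Implicit Defensive.
Import Order.TTheory GRing.Theory Num.Theory.
Local Open Scope classical_set_scope.
Local Open Scope ring_scope.

(* At exponent oo only the support of a semi-coupling matters. The support of a
   semi-coupling of a fully supported measure has dense first projection, so
   moving points by epsilon turns it into the graph of a function X -> Y;
   conversely, a function made constant on the cells of a countable Borel
   partition of mesh epsilon is measurable, and its graph carries a
   semi-coupling. Hence the distance is the infimum of distortions of functions.
   Composing functions gives the triangle inequality. At distance 0, ultrafilter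
   limits give isometric embeddings in both directions, which between compact
   spaces are onto. The distance is bounded by d_GH, and conversely a sequence
   tending to C for it has a d_GH-convergent subsequence, whose limit can only
   be C.
   For finite p, d_srGW ignores the measure of its second argument. Two points
   at distance 1 with weights (1/2, 1/2) and with weights (1/4, 3/4) are thus at
   distance 0, but they have different distances to the one-point space. *)

(** * Distortions of relations and functions between metric spaces *)

Section SemiRelaxedGromovHausdorff.
Context {R : realType}.
Implicit Types X Y Z K L : pMetricType R.

(** Only finite elements of [B] need approximating: [+oo] bounds everything and [-oo] is excluded by
    nonnegativity. *)
Lemma ereal_inf_le_approx (A B : set (\bar R)) :
  (forall r e : R, B r%:E -> 0 < e -> exists2 a, A a & (a <= (r + e)%:E)%E) ->
  (forall b, B b -> (0 <= b)%E) ->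
  (ereal_inf A <= ereal_inf B)%E.
Proof.
move=> AB B0; apply: le_ereal_inf_tmp => -[r| |] Bb.
- apply/lee_addgt0Pr => e e0; have [a Aa ale] := AB _ _ Bb e0.
  by apply: ge_ereal_inf; exists a.
- by rewrite leey.
- by have := B0 _ Bb.
Qed.

(** Trades the extended supremum for real inequalities open to linear arithmetic; the factor 2
    undoes the one half in the distortion. *)
Lemma rel_distortion_leP X Y (S : set (X * Y)) (r : R) :
  (rel_distortion S <= r%:E)%E <->
  (forall z z', S z -> S z' -> discrepancy z z' <= 2 * r).
Proof.
rewrite /rel_distortion.
rewrite lee_pdivrMl// -EFinM; split => [h z z' Sz Sz'|h].
  rewrite -lee_fin; apply: le_trans h.
  by apply: ereal_sup_ubound; exists (z, z').
by apply: ge_ereal_sup => _ [[z z'] [/= Sz Sz'] <-]; rewrite lee_fin h.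
Qed.

Lemma fun_distortion_leP X Y (f : X -> Y) (r : R) :
  (fun_distortion f <= r%:E)%E <->
  (forall x x', `|mdist x x' - mdist (f x) (f x')| <= 2 * r).
Proof.
rewrite /fun_distortion lee_pdivrMl// -EFinM; split => [h x x'|h].
  rewrite -lee_fin; apply: le_trans h.
  by apply: ereal_sup_ubound; exists (x, x').
by apply: ge_ereal_sup => _ [[x x'] _ <-]; rewrite lee_fin h.
Qed.

Lemma rel_distortion_ge0 X Y (S : set (X * Y)) :
  S !=set0 -> (0 <= rel_distortion S)%E.
Proof.
move=> [z Sz]; rewrite /rel_distortion mule_ge0//.
apply: (@le_trans _ _ (discrepancy z z)%:E); first by rewrite lee_fin normr_ge0.
by apply: ereal_sup_ubound; exists (z, z).
Qed.

Lemma fun_distortion_ge0 X Y (f : X -> Y) : (0 <= fun_distortion f)%E.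
Proof.
rewrite /fun_distortion mule_ge0//.
apply: (@le_trans _ _ `|mdist (@point X) point - mdist (f point) (f point)|%:E).
  by rewrite lee_fin normr_ge0.
by apply: ereal_sup_ubound; exists (point, point).
Qed.

(** A graph is a semi-correspondence with the distortion of its function; conversely, choosing one
    partner for each point of [X] keeps a subset of the relation, so the supremum does not grow. *)
Lemma d_srGHE X Y : d_srGH X Y = ereal_inf (range (@fun_distortion R X Y)).
Proof.
apply/eqP; rewrite eq_le; apply/andP; split; apply: le_ereal_inf_tmp.
- move=> _ [f _ <-]; apply: ereal_inf_lbound; exists [set z | z.2 = f z.1].
    by apply/seteqP; split => // x _; exists (x, f x).
  rewrite /rel_distortion /fun_distortion; congr (_ * ereal_sup _)%E.
  apply/seteqP; split.
    by move=> _ [[[x y] [x' y']] [/= -> ->] <-]; exists (x, x').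
  by move=> _ [[x x'] _ <-]; exists ((x, f x), (x', f x')).
- move=> _ [S /seteqP[_ SX] <-].
  have /choice[f Sf] x : exists y, S (x, y).
    by have [[x' y] Sxy /= <-] := SX x I; exists y.
  apply: le_trans (_ : (fun_distortion f <= _)%E).
    by apply: ereal_inf_lbound; exists f.
  apply: lee_wpmul2l; first by rewrite lee_fin.
  apply: ereal_sup_le.
  move=> _ [[x x'] _ <-]/=.
  by exists ((x, f x), (x', f x')) => //; split; exact: Sf.
Qed.

Lemma hd_srGHE X Y : hd_srGH X Y = d_mGH X Y.
Proof. by rewrite /hd_srGH !d_srGHE. Qed.

Lemma d_srGH_ge0 X Y : (0 <= d_srGH X Y)%E.
Proof.
rewrite d_srGHE; apply: le_ereal_inf_tmp => _ [f _ <-].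
exact: fun_distortion_ge0.
Qed.

Lemma d_srGH_lt X Y (r : R) : (d_srGH X Y < r%:E)%E ->
  exists f : X -> Y, forall x x',
    `|mdist x x' - mdist (f x) (f x')| <= 2 * r.
Proof.
rewrite d_srGHE => /ereal_inf_lt[_ [f _ <-] /ltW/fun_distortion_leP fr].
by exists f.
Qed.

Lemma d_srGH_le X Y (r : R) (f : X -> Y) :
  (forall x x', `|mdist x x' - mdist (f x) (f x')| <= 2 * r) ->
  (d_srGH X Y <= r%:E)%E.
Proof.
move=> /fun_distortion_leP fr; rewrite d_srGHE; apply: ge_ereal_inf.
by exists (fun_distortion f) => //; exists f.
Qed.

Lemma d_srGH_triangle X Y Z : (d_srGH X Z <= d_srGH X Y + d_srGH Y Z)%E.
Proof.
have := d_srGH_ge0 X Y; have := d_srGH_ge0 Y Z.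
case YZ : (d_srGH Y Z) => [s| |]//; last first.
  by move=> _; case: (d_srGH X Y) => //= *; rewrite leey.
case XY : (d_srGH X Y) => [r| |]// _ _; last by rewrite leey.
rewrite -EFinD; apply/lee_addgt0Pr => e e0.
have [|f fr] := @d_srGH_lt X Y (r + e / 2).
  by rewrite XY lte_fin ltrDl divr_gt0.
have [|g gs] := @d_srGH_lt Y Z (s + e / 2).
  by rewrite YZ lte_fin ltrDl divr_gt0.
apply: (@d_srGH_le _ _ _ (g \o f)) => x x' /=.
by have := fr x x'; have := gs (f x) (f x'); rewrite !ler_norml; lra.
Qed.

Lemma hd_srGH_ge0 X Y : (0 <= hd_srGH X Y)%E.
Proof. by rewrite le_max d_srGH_ge0. Qed.

Lemma hd_srGH_sym X Y : hd_srGH X Y = hd_srGH Y X.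
Proof. by rewrite /hd_srGH maxC. Qed.

Lemma hd_srGH_triangle X Y Z : (hd_srGH X Z <= hd_srGH X Y + hd_srGH Y Z)%E.
Proof.
rewrite [leLHS]/hd_srGH ge_max; apply/andP; split.
  by apply: (le_trans (d_srGH_triangle X Y Z)); rewrite leeD// le_max lexx.
apply: (le_trans (d_srGH_triangle Z Y X)).
by rewrite addeC leeD// le_max lexx orbT.
Qed.

(** * Isometry invariance and comparison with the Gromov-Hausdorff distance *)

Lemma isometric_refl X : isometric X X.
Proof. by exists id => //; exists id. Qed.

Lemma isometric_sym X Y : isometric X Y -> isometric Y X.
Proof.
move=> [f [g fK gK] fiso]; exists g; first by exists f.
by move=> y y'; rewrite -{2}(gK y) -{2}(gK y') fiso.
Qed.

Lemma isometric_trans X Y Z : isometric X Y -> isometric Y Z -> isometric X Z.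
Proof.
move=> [f fb fiso] [g gb giso]; exists (g \o f); first exact: bij_comp.
by move=> x x' /=; rewrite giso fiso.
Qed.

Lemma isometric_d_srGH X Y : isometric X Y -> d_srGH X Y = 0%E.
Proof.
move=> [f _ fiso]; apply/eqP; rewrite eq_le d_srGH_ge0 andbT.
by apply: (@d_srGH_le _ _ 0 f) => x x'; rewrite fiso subrr normr0 mulr0.
Qed.

Lemma isometric_hd_srGH X Y : isometric X Y -> hd_srGH X Y = 0%E.
Proof.
move=> XY; rewrite /hd_srGH !isometric_d_srGH ?maxxx//.
exact: isometric_sym.
Qed.

(** Two triangle inequalities through isometric copies at distance 0. This makes the distance well
    defined on isometry classes. *)
Lemma hd_srGH_isometric X X' Y Y' :
  isometric X X' -> isometric Y Y' -> hd_srGH X Y = hd_srGH X' Y'.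
Proof.
have le (A A' B B' : pMetricType R) : isometric A A' -> isometric B B' ->
    (hd_srGH A B <= hd_srGH A' B')%E.
  move=> AA' BB'; apply: le_trans (hd_srGH_triangle A A' B) _.
  rewrite isometric_hd_srGH// add0e.
  apply: le_trans (hd_srGH_triangle A' B' B) _.
  by rewrite (isometric_hd_srGH (isometric_sym BB')) adde0.
move=> XX' YY'; apply/eqP; rewrite eq_le.
by rewrite !le//; exact: isometric_sym.
Qed.

(** A correspondence and its transpose are both semi-correspondences, with equal distortions. *)
Lemma hd_srGH_le_d_GH X Y : (hd_srGH X Y <= d_GH X Y)%E.
Proof.
rewrite /hd_srGH ge_max; apply/andP; split;
  apply: le_ereal_inf_tmp => _ [S [S1 S2] <-].
  by apply: ereal_inf_lbound; exists S.
apply: ereal_inf_lbound; exists [set z | S (z.2, z.1)].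
  apply/seteqP; split => // y _; have /seteqP[_ /(_ y I)] := S2.
  by move=> [[x y'] Sxy /= <-]; exists (y', x).
rewrite /rel_distortion; congr (_ * ereal_sup _)%E.
apply/seteqP; split=> _ [[[x y] [x' y']] [/= Sz Sz'] <-];
  by exists ((y, x), (y', x')) => //=; rewrite /discrepancy/= distrC.
Qed.

Lemma d_GH_sym X Y : d_GH X Y = d_GH Y X.
Proof.
suff le (A B : pMetricType R) : (d_GH A B <= d_GH B A)%E.
  by apply/eqP; rewrite eq_le !le.
apply: le_ereal_inf_tmp => _ [S [/seteqP[_ S1] /seteqP[_ S2]] <-].
apply: ereal_inf_lbound; exists [set z | S (z.2, z.1)].
  split; apply/seteqP; split => // y _.
    by have [[x y'] Sxy /= <-] := S2 y I; exists (y', x).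
  by have [[x y'] Sxy /= <-] := S1 y I; exists (y', x).
rewrite /rel_distortion; congr (_ * ereal_sup _)%E.
apply/seteqP; split=> _ [[[x y] [x' y']] [/= Sz Sz'] <-];
  by exists ((y, x), (y', x')) => //=; rewrite /discrepancy/= distrC.
Qed.

(** * Compact metric spaces: finiteness and separation *)

Lemma compact_mdist_bounded K :
  compact [set: K] -> exists M : R, forall x y : K, mdist x y <= M.
Proof.
rewrite compact_cover => /(_ K setT (fun x => (ball x 1)°)) [].
- by move=> x _; exact: open_interior.
- by move=> x _; exists x => //; exact: nbhsx_ballx.
move=> D _ cov.
(* The sum of all distances between centres of the finite cover bounds each of them; the 2 added to
   it pays for two unit radii. *)
pose d := \sum_(i <- enum_fset D) \sum_(j <- enum_fset D) mdist i j.
exists (d + 2).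
move=> x y.
have [i /= Di /interior_subset ix] := cov x I.
have [j /= Dj /interior_subset jy] := cov y I.
move: ix jy; rewrite !ballEmdist /= => ix jy.
have sum_ge (T : eqType) (s : seq T) (F : T -> R) k : k \in s ->
    (forall t, 0 <= F t) -> F k <= \sum_(t <- s) F t.
  move=> ks F0; rewrite (perm_big _ (perm_to_rem ks))/= big_cons lerDl.
  exact: sumr_ge0.
have ij : mdist i j <= d.
  apply: le_trans (sum_ge _ _ _ i Di _).
    by apply: sum_ge => // t; exact: mdist_ge0.
  by move=> t; apply: sumr_ge0 => ? _; exact: mdist_ge0.
have := metric_triangle x i y; have := metric_triangle i j y.
by rewrite (metric_sym x i); lra.
Qed.

Lemma compact_d_srGH_lty K L : compact [set: K] -> (d_srGH K L < +oo)%E.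
Proof.
move=> /compact_mdist_bounded[M bM]; apply: le_lt_trans (ltry (M / 2)).
apply: (@d_srGH_le _ _ _ (fun=> point)) => x x'.
by rewrite mdistxx subr0 ger0_norm ?mdist_ge0// mulrC divfK// bM.
Qed.

Lemma hd_srGH_fin_num K L : compact [set: K] -> compact [set: L] ->
  hd_srGH K L \is a fin_num.
Proof.
move=> cK cL; rewrite ge0_fin_numE ?hd_srGH_ge0//.
by rewrite /hd_srGH gt_max !compact_d_srGH_lty.
Qed.

(** Maps of distortion at most [n.+1%:R^-1] converge pointwise along an ultrafilter finer than
    [\oo]. One ultrafilter serves all points of [K] at once, in place of a diagonal extraction over
    a dense set. *)
Lemma isometric_embedding_limit K L : compact [set: L] ->
  (d_srGH K L <= 0)%E ->
  exists f : K -> L, forall x x', mdist (f x) (f x') = mdist x x'.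
Proof.
move=> cL d0.
have /choice[f fP] (n : nat) : exists f : K -> L, forall x x',
    `|mdist x x' - mdist (f x) (f x')| <= 2 * n.+1%:R^-1.
  by apply: d_srGH_lt; apply: le_lt_trans d0 _; rewrite lte_fin.
have [U [UU oU]] := @ultraFilterLemma nat \oo _.
have /choice[g gP] x : exists y : L, forall e : R, 0 < e ->
    U [set n | mdist y (f n x) < e].
  have [y [_ cly]] := cL ((f ^~ x) @ U) _ filterT.
  exists y => e e0.
  (* A cluster point of an ultrafilter is a limit: otherwise the complement of the ball would belong
     to it. *)
  have [//|nU] := in_ultra_setVsetC [set n | mdist y (f n x) < e] UU.
  have nB : U (fun n => ~ ball y e (f n x)).
    by apply: filterS nU => n /= nB; rewrite ballEmdist.
  by have [z []] := cly (~` ball y e) (ball y e) nB (nbhsx_ballx _ _ e0).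
exists g => x x'; apply/eqP; rewrite -subr_eq0 -normr_eq0 eq_le normr_ge0 andbT.
apply/ler_addgt0Pl => e e0; rewrite addr0.
(* The error consists of two displacements below [e / 4] and of [2 * n.+1%:R^-1], which is below
   [e / 2]. *)
have e40 : 0 < e / 4 by rewrite divr_gt0.
have [N _ NP] : \forall n \near \oo, n.+1%:R^-1 < e / 4.
  exact: (near_infty_natSinv_lt (PosNum e40)).
have UN : U [set n | (N <= n)%N] by apply: oU; exists N.
have [n [/= [Nn xn] x'n]] :=
  filter_ex (filterI (filterI UN (gP x _ e40)) (gP x' _ e40)).
have := fP n x x'; have := NP n Nn => /=.
have := metric_triangle (g x) (f n x) (g x').
have := metric_triangle (f n x) (f n x') (g x').
have := metric_triangle (f n x) (g x) (f n x').
have := metric_triangle (g x) (g x') (f n x').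
rewrite (metric_sym (f n x) (g x)) (metric_sym (f n x') (g x')).
have /= ? := xn; have /= ? := x'n.
set a := mdist (f n x) (g x'); set b := mdist (g x) (f n x').
set t := n.+1%:R^-1.
by rewrite !ler_norml => ? ? ? ? ? /andP[? ?]; apply/andP; split; lra.
Qed.

(* Iterating h shows that x returns arbitrarily close to itself, so x is in the
   closure of the range of h. *)
Lemma isometric_self_embedding_surj K (h : K -> K) : compact [set: K] ->
  (forall x x', mdist (h x) (h x') = mdist x x') -> forall x, exists y, h y = x.
Proof.
move=> cK hiso x.
have iter_iso n y y' : mdist (iter n h y) (iter n h y') = mdist y y'.
  by elim: n => //= n IH; rewrite hiso.
have ret (e : R) : 0 < e -> exists y, mdist x (h y) < e.
  move=> e0; have e20 : 0 < e / 2 by rewrite divr_gt0.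
  have [c [_ clc]] := cK ((fun n => iter n h x) @ \oo) _ filterT.
  have near m : exists2 n, (m <= n)%N & mdist c (iter n h x) < e / 2.
    have tail : ((fun n => iter n h x) @ \oo)
        ((fun n => iter n h x) @` [set n | (m <= n)%N]).
      by exists m => // n /= mn; exists n.
    have [_ [/= [n mn <-]]] := clc _ _ tail (nbhsx_ballx _ _ e20).
    by rewrite ballEmdist; exists n.
  (* Two iterates near [c], the second strictly later; cancelling the first [m] applications of [h]
     leaves [x] close to a positive iterate of itself. *)
  have [m _ cm] := near 0%N; have [n mn cn] := near m.+1.
  exists (iter (n - m.+1) h x).
  rewrite -[h _]/(iter (n - m.+1).+1 h x) -(iter_iso m) -iterD.
  rewrite subnSK// subnKC; last exact: ltnW.
  have := metric_triangle (iter m h x) c (iter n h x).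
  by rewrite (metric_sym _ c); lra.
(* The filter of points whose images approach [x]; since [h] is isometric, it sends a cluster point
   of [F] to [x] itself. *)
pose F := filter_from [set e : R | 0 < e]
  (fun e => [set y | mdist x (h y) < e]).
have PF : ProperFilter F.
  apply: filter_from_proper => [|e e0]; last exact: ret.
  apply: filter_from_filter; first by exists 1 => /=.
  move=> i j i0 j0; exists (Num.min i j); first by rewrite /= lt_min i0 j0.
  by move=> y /=; rewrite lt_min => /andP[].
have [y [_ cly]] := cK F PF filterT; exists y.
apply/esym/mdist_positivity; apply/eqP; rewrite eq_le mdist_ge0 andbT.
apply/ler_addgt0Pl => e e0; rewrite addr0.
have e20 : 0 < e / 2 by rewrite divr_gt0.
have Fe : F [set y | mdist x (h y) < e / 2] by exists (e / 2).
have [y' [/= xy']] := cly _ _ Fe (nbhsx_ballx _ _ e20).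
rewrite ballEmdist/= => yy'.
have := metric_triangle x (h y') (h y).
by rewrite hiso (metric_sym y'); lra.
Qed.

(** Isometric embeddings [f] and [g] in opposite directions compose to a self-embedding of [L],
    which is onto by compactness; hence [f] is onto. *)
Lemma hd_srGH_eq0 K L : compact [set: K] -> compact [set: L] ->
  hd_srGH K L = 0%E -> isometric K L.
Proof.
move=> cK cL KL0.
have [|f fiso] := @isometric_embedding_limit K L cL.
  by rewrite -KL0 le_max lexx.
have [|g giso] := @isometric_embedding_limit L K cK.
  by rewrite -KL0 le_max lexx orbT.
have inj : injective f.
  by move=> x x' E; apply: mdist_positivity; rewrite -fiso E mdistxx.
have /choice[k kK] y : exists x, f x = y.
  have [|z] := @isometric_self_embedding_surj L (f \o g) cL _ y.
    by move=> x x' /=; rewrite fiso giso.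
  by move=> /= <-; exists (g z).
exists f => //; exists k => // x; apply: inj; exact: kK.
Qed.

End SemiRelaxedGromovHausdorff.

(** * Exponent infinity: supports of semi-couplings *)

Section InfiniteExponent.
Context {R : realType}.
Implicit Types X Y : mmSpace R.

Lemma open_mdist_lt (T : pMetricType R) (x : T) (e : R) :
  open [set y | mdist x y < e].
Proof.
rewrite openE => y /= xy; apply/nbhs_ballP; exists (e - mdist x y) => /=.
  by rewrite subr_gt0.
by move=> z; rewrite ballEmdist /= => yz; have := metric_triangle x y z; lra.
Qed.

Lemma open_cylinder (S T : pMetricType R) (A : set S) :
  open A -> open (A `*` [set: T] : set (S * T)%type).
Proof.
move=> oA; rewrite openE => z [/= Az _].
have /nbhs_ballP[r r0 rA] : nbhs z.1 A by exact: open_nbhs_nbhs.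
by apply/nbhs_ballP; exists r => // w [/= /rA].
Qed.

Lemma open_slice (S T : pMetricType R) (U : set (S * T)) (t : T) :
  open U -> open [set s | U (s, t)].
Proof.
move=> oU; rewrite openE => s Us.
have /nbhs_ballP[r r0 rU] : nbhs (s, t) U by exact: open_nbhs_nbhs.
apply/nbhs_ballP; exists r => // w sw; apply: rU; split => //=.
exact: ballxx.
Qed.

Lemma countable_dense_sequence (T : pMetricType R) (A : set T) :
  countable A -> dense A ->
  exists a : nat -> T, forall x (e : R), 0 < e -> exists n, mdist x (a n) < e.
Proof.
move=> /countable_injP[f finj] dA.
(* [f] injects [A] into the natural numbers; [a] inverts it, with [point] at the indices that are
   not reached. *)
have /choice[a aP] (n : nat) : exists y, forall x, A x -> f x = n -> y = x.
  have [[x [Ax fx]]|nx] := pselect (exists x, A x /\ f x = n).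
    exists x => x' Ax' fx'.
    by apply: finj; [exact: mem_set|exact: mem_set|rewrite fx'].

  by exists point => x Ax fx; case: nx; exists x.
exists a => x e e0.
have [|y [/interior_subset + Ay]] := dA (ball x e)° _ (open_interior _).
  by exists x; exact: nbhsx_ballx.
by rewrite ballEmdist => xy; exists (f y); rewrite (aP _ _ Ay erefl).
Qed.

Lemma mm_dense_sequence X : exists a : nat -> X,
  forall x (e : R), 0 < e -> exists n, mdist x (a n) < e.
Proof.
by have [A cA dA] := mm_separable X; exact: countable_dense_sequence dA.
Qed.

Lemma pushforward_probability d d' (T : measurableType d)
    (T' : measurableType d') (P : probability T R) (f : T -> T') :
  measurable_fun setT f ->
  exists Q : probability T' R, forall A, Q A = P (f @^-1` A).
Proof.
move=> mf.
pose F : {mfun T >-> T'} := HB.pack f (isMeasurableFun.Build _ _ _ _ _ mf).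
by exists (distribution P F).
Qed.

Lemma open_borel_measurable (T : ptopologicalType) (U : set T) :
  open U -> measurable (U : set (borelType T)).
Proof. exact: sub_sigma_algebra. Qed.

Lemma measurable_fun_borel d (S : measurableType d) (T : ptopologicalType)
    (f : S -> T) : (forall U, open U -> measurable (f @^-1` U)) ->
  measurable_fun setT (f : S -> borelType T).
Proof.
move=> mf; apply: (@measurability _ _ _ (borelType T) _ _ (@open T)) => //.
move=> _ [U oU <-].
by rewrite setTI; exact: mf.
Qed.

(** A neighbourhood of a support point has positive mass, so its preimage is nonempty: the support
    lies in the closure of the range of [f]. *)
Lemma msupport_pushforward_closure d (S : measurableType d)
    (T : ptopologicalType) (P : probability S R)
    (Q : probability (borelType T) R) (f : S -> T) :
  (forall A, Q A = P (f @^-1` A)) ->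
  forall z U, msupport Q z -> open U -> U z -> exists s, U (f s).
Proof.
move=> QP z U zs oU Uz; have := zs _ oU Uz; rewrite QP.
have [->|/set0P[s Us] _] := eqVneq (f @^-1` U) set0; last by exists s.
by rewrite measure0 ltxx.
Qed.

(** Otherwise every point of a cylinder over a ball has a null open neighbourhood; by separability
    countably many null open sets cover the cylinder, which is then null although its base has
    positive mass. *)
Lemma semi_coupling_support_dense X (Y : mmSpace R)
    (gamma : probability (borelType (X * Y)%type) R) :
  full_support X -> semi_coupling (mm_measure X) gamma ->
  forall (x : X) (e : R), 0 < e ->
    exists2 z, msupport gamma z & mdist x z.1 < e.
Proof.
move=> fX scg x e e0; apply: contrapT => nz.
have {}nz z : mdist x z.1 < e ->
    exists U : set (X * Y), [/\ open U, U z & gamma U = 0%E].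
  move=> xz; apply: contrapT => nU; apply: nz; exists z => //= U oU Uz.
  rewrite lt_neqAle measure_ge0 andbT; apply/eqP => gU; apply: nU.
  by exists U.
have [a aP] := mm_dense_sequence X; have [b bP] := mm_dense_sequence Y.
(* A countable base of the product, centred at pairs of dense points; [N] retains its null
   members. *)
pose W i j n : set (X * Y) := (ball (a i, b j) (n.+1%:R^-1 + n.+1%:R^-1))°.
pose N i j n := if gamma (W i j n) == 0%E then W i j n else set0.
have negN : gamma.-negligible (\bigcup_i \bigcup_j \bigcup_n N i j n).
  apply: negligible_bigcup => i; apply: negligible_bigcup => j.
  apply: negligible_bigcup => n; rewrite /N; case: ifPn => [/eqP gW|_].
    exists (W i j n); split => //.
    exact: open_borel_measurable (open_interior _).
  exact: negligible_set0.
have ballN : (ball x e)° `*` [set: Y] `<=`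
    \bigcup_i \bigcup_j \bigcup_n N i j n.
  move=> z [/interior_subset + _]; rewrite ballEmdist => /nz[U [oU Uz gU]].
  have /nbhs_ballP[r /= r0 zrU] : nbhs z U by exact: open_nbhs_nbhs.
  (* A set [W i j n] has radius [2 / n.+1] and its centre is within [1 / n.+1] of [z], so it stays
     within [3 / n.+1] of [z]. *)
  have r30 : 0 < r / 3 by rewrite divr_gt0.
  have [n _ /(_ n (leqnn n)) nr] : \forall n \near \oo, n.+1%:R^-1 < r / 3.
    exact: (near_infty_natSinv_lt (PosNum r30)).
  have n0 : (0 : R) < n.+1%:R^-1 by rewrite invr_gt0.
  have [i iz] := aP z.1 _ n0; have [j jz] := bP z.2 _ n0.
  have cz : ball (a i, b j) (n.+1%:R^-1 : R) z.
    by split => /=; rewrite ballEmdist/= metric_sym.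
  have Wz : W i j n z.
    rewrite /W /interior; apply/nbhs_ballP; exists n.+1%:R^-1 => //= w.
    exact: ball_triangle cz.
  exists i => //; exists j => //; exists n => //; rewrite /N ifT//.
  apply/eqP; apply: (@subset_measure0 _ _ _ gamma _ U) => //.
  - exact: open_borel_measurable (open_interior _).
  - exact: open_borel_measurable.
  - move=> w /interior_subset cw; apply: zrU.
    apply: (@le_ball _ _ _ (n.+1%:R^-1 + (n.+1%:R^-1 + n.+1%:R^-1))).
      by set t := n.+1%:R^-1 in nr *; lra.
    by apply: ball_triangle cw; exact: ball_sym.
have mB : measurable ((ball x e)° : set (borelType X)).
  exact: open_borel_measurable (open_interior _).
have /negligibleP gB : gamma.-negligible ((ball x e)° `*` [set: Y]).
  exact: negligibleS negN.
have : (0 < mm_measure X (ball x e)°)%E.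
  have : msupport (mm_measure X) x by rewrite fX.
  by apply; [exact: open_interior|exact: nbhsx_ballx].
rewrite -scg// gB ?ltxx//.
by apply: open_borel_measurable; exact/open_cylinder/open_interior.
Qed.

Lemma d_srGH_le_d_srGW X Y : full_support X ->
  (d_srGH X Y <= d_srGW +oo%E X Y)%E.
Proof.
move=> fX; rewrite d_srGHE.
apply: ereal_inf_le_approx => [r e [gamma scg gr] e0|].
  (* Replacing each point of [X] by the first coordinate of a nearby support point changes distances
     by less than [2 * e], hence the distortion by at most [e]. *)
  have /choice[k kP] x : exists z, msupport gamma z /\ mdist x z.1 < e.
    by have [z] := semi_coupling_support_dense fX scg x e0; exists z.
  exists (fun_distortion (snd \o k)); first by exists (snd \o k).
  apply/fun_distortion_leP => x x' /=.
  have [[kx xk] [kx' xk']] := (kP x, kP x').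
  have /rel_distortion_leP/(_ _ _ kx kx') :
    (rel_distortion (msupport gamma) <= r%:E)%E by rewrite -gr.
  have := metric_triangle x (k x).1 x'.
  have := metric_triangle (k x).1 (k x').1 x'.
  have := metric_triangle (k x).1 x (k x').1.
  have := metric_triangle x x' (k x').1.
  rewrite /discrepancy (metric_sym (k x).1 x) (metric_sym (k x').1 x').
  set p := mdist (k x).1 x'; set q := mdist x (k x').1.
  by rewrite !ler_norml => ? ? ? ? /andP[? ?]; apply/andP; split; lra.
move=> _ [gamma scg <-]; apply: rel_distortion_ge0.
by have [z zg _] := semi_coupling_support_dense fX scg point ltr01; exists z.
Qed.

(** The least-index rule cuts the balls around the [a n] into disjoint cells, each a ball minus the
    earlier ones. *)
Lemma measurable_first_index (X : mmSpace R) (a : nat -> X) (e : R)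
    (aP : forall x, exists n, mdist x (a n) < e) (n : nat) :
  measurable ([set x | ex_minn (aP x) = n] : set (borelType X)).
Proof.
pose B m : set (borelType X) := [set x : X | mdist x (a m) < e].
have mB m : measurable (B m).
  have -> : B m = [set y | mdist (a m) y < e].
    by apply/seteqP; split => y; rewrite /B /= metric_sym.
  by apply: open_borel_measurable; exact: open_mdist_lt.
rewrite (_ : [set _ | _] = B n `\` \bigcup_(m in [set m | (m < n)%N]) B m).
  by apply: measurableD => //; apply: bigcup_measurable.
apply/seteqP; split=> x /=.
  case: ex_minnP => m mB' mmin <-; split => // -[k /= km Bk].
  by have := mmin _ Bk; rewrite leqNgt km.
move=> [Bn nB]; case: ex_minnP => m mB' mmin; apply/eqP.
rewrite eqn_leq mmin//= leqNgt; apply/negP => mn; apply: nB; by exists m.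
Qed.

Lemma d_srGW_le_d_srGH X Y : (d_srGW +oo%E X Y <= d_srGH X Y)%E.
Proof.
rewrite d_srGHE; apply: ereal_inf_le_approx => [r e [f _ fr] e0|]; last first.
  by move=> _ [f _ <-]; exact: fun_distortion_ge0.
(* Passing from two support points to the centres of cells costs six displacements below [e / 4],
   within the available [2 * e]. *)
have e40 : 0 < e / 4 by rewrite divr_gt0.
have [a aP] := mm_dense_sequence X.
pose k x := ex_minn (aP x _ e40).
(* The graph map of a function constant on each cell, hence measurable although [f] is arbitrary. *)
pose g x := (x, f (a (k x))).
have [|gamma gE] := @pushforward_probability _ _ _ (borelType (X * Y)%type)
    (mm_measure X) g.
  apply: measurable_fun_borel => U oU.
  rewrite (_ : g @^-1` U = \bigcup_n
      ([set x | k x = n] `&` [set x | U (x, f (a n))])); last first.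
    apply/seteqP; split => x /=; first by move=> Ux; exists (k x).
    by move=> [n _ [<-]].
  apply: bigcup_measurable => n _; apply: measurableI.
    exact: measurable_first_index.
  by apply: open_borel_measurable; exact: open_slice.
exists (measure_distortion +oo%E gamma).
  exists gamma => // A mA; rewrite gE; congr (mm_measure X _).
  by apply/seteqP; split => x //= [].
rewrite /=; apply/rel_distortion_leP => z z' zg zg'.
(* The support is only known to lie in the closure of the graph, so its points are approximated by
   points of the graph. *)
have near w : msupport gamma w ->
    exists x, mdist w.1 x < e / 4 /\ mdist w.2 (f (a (k x))) < e / 4.
  move=> wg.
  have [|x /interior_subset[]] := msupport_pushforward_closure gE wg
    (open_interior (ball w (e / 4))); first exact: nbhsx_ballx.
  by rewrite !ballEmdist; exists x.
have [x [zx zfx]] := near _ zg; have [x' [zx' zfx']] := near _ zg'.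
have kP y : mdist y (a (k y)) < e / 4 by rewrite /k; case: ex_minnP.
have := kP x; have := kP x'.
have /fun_distortion_leP/(_ (a (k x)) (a (k x'))) :
  (fun_distortion f <= r%:E)%E by rewrite fr.
rewrite /discrepancy.
have mdistD (T : pMetricType R) (p q p' q' : T) :
    `|mdist p q - mdist p' q'| <= mdist p p' + mdist q q'.
  have := metric_triangle p p' q; have := metric_triangle p' q' q.
  have := metric_triangle p' p q'; have := metric_triangle p q q'.
  rewrite (metric_sym p' p) (metric_sym q' q).
  set u := mdist p' q; set v := mdist p q'.
  by rewrite ler_norml => ? ? ? ?; apply/andP; split; lra.
have := mdistD _ z.1 z'.1 x x'; have := mdistD _ x x' (a (k x)) (a (k x')).
have := mdistD _ z.2 z'.2 (f (a (k x))) (f (a (k x'))).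
rewrite !ler_norml => /andP[? ?] /andP[? ?] /andP[? ?] /andP[? ?] ? ?.
by apply/andP; split; lra.
Qed.

Lemma d_srGW_infty X Y : full_support X -> d_srGW +oo%E X Y = d_srGH X Y.
Proof.
move=> fX; apply/eqP.
by rewrite eq_le d_srGW_le_d_srGH d_srGH_le_d_srGW.
Qed.

End InfiniteExponent.

(** * Isometry classes of compact metric spaces *)

Section IsometryClasses.
Context {R : realType}.
Implicit Types C : isoClass R.

Lemma isoClass_compact C (K : pMetricType R) :
  iso_class C K -> compact [set: K].
Proof.
case: C => S [K0 cK0 SE] /=; rewrite SE => -[f [g fK gK] fiso].
have <- : f @` [set: K0] = setT.
  by apply/seteqP; split => // y _; exists (g y).
apply: continuous_compact => //; apply: continuous_subspaceT => x.
apply/cvg_ballP => e e0; apply: filterS (nbhsx_ballx x e e0) => y.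
by rewrite !ballEmdist /= fiso.
Qed.

Lemma isoClass_isometric C (K L : pMetricType R) :
  iso_class C K -> iso_class C L -> isometric K L.
Proof.
case: C => S [K0 cK0 SE] /=; rewrite SE => KK0 LL0.
exact: isometric_trans (isometric_sym KK0) LL0.
Qed.

Lemma isoClass_closed C (K L : pMetricType R) :
  iso_class C K -> isometric K L -> iso_class C L.
Proof.
case: C => S [K0 cK0 SE] /=; rewrite SE; exact: isometric_trans.
Qed.

Lemma isoClass_inhabited C : exists K : pMetricType R, iso_class C K.
Proof.
case: C => S [K cK SE] /=; exists K; rewrite SE; exact: isometric_refl.
Qed.

Lemma isoClass_eq C C' (K L : pMetricType R) :
  iso_class C K -> iso_class C' L -> isometric K L -> C = C'.
Proof.
move=> CK C'L KL; have : iso_class C = iso_class C'.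
  apply/seteqP; split => M CM.
    apply: isoClass_closed C'L _; apply: isometric_trans (isometric_sym KL) _.
    exact: isoClass_isometric CK CM.
  apply: isoClass_closed CK _; apply: isometric_trans KL _.
  exact: isoClass_isometric C'L CM.
case: C C' {CK C'L} => [S p] [S' p'] /= SS'; rewrite SS' in p *.
by congr IsoClass; exact: Prop_irrelevance.
Qed.

Definition isoClass_repr C : pMetricType R :=
  projT1 (cid (isoClass_inhabited C)).

Lemma isoClass_reprP C : iso_class C (isoClass_repr C).
Proof. exact: projT2 (cid (isoClass_inhabited C)). Qed.

Lemma isoClass_repr_compact C : compact [set: isoClass_repr C].
Proof. exact: isoClass_compact (isoClass_reprP C). Qed.

(** Isometry invariance makes the choice of representatives immaterial. *)
Definition hd_srGH_class C C' : \bar R :=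
  hd_srGH (isoClass_repr C) (isoClass_repr C').

Lemma hd_srGH_classE C C' (K L : pMetricType R) :
  iso_class C K -> iso_class C' L -> hd_srGH_class C C' = hd_srGH K L.
Proof.
move=> CK C'L; apply: hd_srGH_isometric.
  exact: isoClass_isometric (isoClass_reprP C) CK.
exact: isoClass_isometric (isoClass_reprP C') C'L.
Qed.

Lemma hd_srGH_class_metric : is_metric hd_srGH_class.
Proof.
split; first split.
- by move=> C C' _ _; exact: hd_srGH_ge0.
- by move=> C _; apply: isometric_hd_srGH; exact: isometric_refl.
- by move=> C C' _ _; exact: hd_srGH_sym.
- by move=> C C' C'' _ _ _; exact: hd_srGH_triangle.
- by move=> C C'; apply: hd_srGH_fin_num; exact: isoClass_repr_compact.
- move=> C C' CC'0; apply: isoClass_eq (isoClass_reprP C) (isoClass_reprP C') _.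
  by apply: hd_srGH_eq0 => //; exact: isoClass_repr_compact.
Qed.

Lemma d_GH_class_sym C C' : d_GH_class C C' = d_GH_class C' C.
Proof.
rewrite /d_GH_class; congr ereal_inf.
apply/seteqP; split=> _ [[K L] [/= CK CL] <-];
  by exists (L, K) => //=; exact: d_GH_sym.
Qed.

Lemma hd_srGH_class_le C C' : (hd_srGH_class C C' <= d_GH_class C C')%E.
Proof.
apply: le_ereal_inf_tmp => _ [[K L] [/= CK CL] <-].
by rewrite (hd_srGH_classE CK CL); exact: hd_srGH_le_d_GH.
Qed.

Lemma hd_srGH_class_topology (F : set (isoClass R)) :
  precompact_family d_GH_class F ->
  topologically_equivalent_on F hd_srGH_class d_GH_class.
Proof.
move=> pF U; split=> -[UF oU]; split => // C UC; have [e e0 eU] := oU C UC.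
  (* [hd_srGH_class] is the smaller distance, so the same radius serves. *)
  exists e => // C' FC' CC'; apply: eU => //.
  exact: le_lt_trans (hd_srGH_class_le _ _) CC'.
(* If no radius works, some sequence in [F] outside [U] tends to [C] for the smaller distance;
   precompactness gives a subsequence with a limit [l] for [d_GH_class]. *)
apply: contrapT => nU.
have /choice[u uP] (n : nat) : exists C', [/\ F C',
    (hd_srGH_class C C' < n.+1%:R^-1%:E)%E & ~ U C'].
  apply: contrapT => nC'; apply: nU; exists n.+1%:R^-1.
    by rewrite invr_gt0.
  by move=> C' FC' CC'; apply: contrapT => nUC'; apply: nC'; exists C'.
have [|phi [l [phi_incr ul]]] := pF u; first by move=> n; have [] := uP n.
have phi_ge n : (n <= phi n)%N.
  by elim: n => // n IH; apply: leq_ltn_trans IH _; exact: phi_incr.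
have close (r : R) : 0 < r -> exists n,
    (d_GH_class (u (phi n)) l < r%:E)%E /\
    (hd_srGH_class C (u (phi n)) < r%:E)%E.
  move=> r0.
  have [N1 _ N1P] : \forall n \near \oo, (d_GH_class (u (phi n)) l < r%:E)%E.
    apply: (ul [set x | (x < r%:E)%E]); apply: open_nbhs_nbhs.
    by split; [exact: open_ereal_lt_ereal|rewrite /= lte_fin].
  have [N2 _ N2P] : \forall n \near \oo, n.+1%:R^-1 < r.
    exact: (near_infty_natSinv_lt (PosNum r0)).
  exists (maxn N1 N2); split; first by apply: N1P; exact: leq_maxl.
  have [_ /lt_trans + _] := uP (phi (maxn N1 N2)); apply; rewrite lte_fin.
  by apply: N2P => /=; apply: leq_trans (phi_ge _); exact: leq_maxr.
(* For the smaller distance the subsequence approaches both [C] and [l]; the metric axioms hold on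
   all classes, so [l] may lie outside [F]. *)
have Cl : C = l.
  have [[D0 _ _ D_tri] _ D_sep] := hd_srGH_class_metric.
  apply: D_sep; apply/eqP; rewrite eq_le D0// andbT.
  apply/lee_addgt0Pr => r r0; rewrite add0e.
  have r20 : 0 < r / 2 by rewrite divr_gt0.
  have [n [un Cn]] := close _ r20.
  apply: le_trans (D_tri C (u (phi n)) l I I I) _.
  rewrite [r]splitr EFinD leeD//; first exact: ltW.
  exact: le_trans (hd_srGH_class_le _ _) (ltW un).
have [n [un _]] := close _ e0.
have [Fn _ nUn] := uP (phi n); apply: nUn; apply: eU => //.
by rewrite Cl d_GH_class_sym.
Qed.

(* The rate 1 is arbitrary; the natural number argument of poisson_prob is a
   dummy. *)
Lemma full_support_probability (K : pMetricType R) (a : nat -> K) :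
  (forall x (e : R), 0 < e -> exists n, mdist x (a n) < e) ->
  exists P : probability (borelType K) R, msupport P = setT.
Proof.
move=> aP.
(* Every natural number has positive Poisson mass, so the image measure charges each open set that
   contains a term of the dense sequence. *)
have [//|P PE] := @pushforward_probability _ _ _ _ (borelType K)
  (@poisson_prob R 1 0) a.
exists P; apply/seteqP; split => // x _ U oU Ux; rewrite PE.
have /nbhs_ballP[r r0 rU] : nbhs x U by exact: open_nbhs_nbhs.
have [n xn] := aP x r r0.
apply: (@lt_le_trans _ _ (@poisson_prob R 1 0 [set n])).
  rewrite /poisson_prob ltr01 esum_set1 ?lee_fin ?poisson_pmf_ge0//.
  rewrite lte_fin /poisson_pmf ltr01 mulr_gt0 ?expR_gt0//.
apply: le_measure; [exact: mem_set|exact: mem_set|move=> _ ->; apply: rU].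
by rewrite ballEmdist.
Qed.

Lemma compact_complete (K : pMetricType R) : compact [set: K] ->
  forall F : set_system K, ProperFilter F -> cauchy F -> cvg F.
Proof. by move=> cK F PF cF; exact: compact_cauchy_cvg cF filterT cK. Qed.

Lemma compact_separable (K : pMetricType R) : compact [set: K] ->
  exists2 A : set K, countable A & dense A.
Proof.
move=> cK; have [B cB [oB Bbase]] := compact_second_countable cK.
(* One point from each nonempty basic open set; [point] fills in for the empty set. *)
have /choice[s sP] (V : set K) : exists x, V !=set0 -> V x.
  by have [[x Vx]|nV] := pselect (V !=set0); [exists x|exists point].
exists (s @` B); first exact: sub_countable (card_image_le _ _) cB.
move=> O [x Ox] oO.
have [V [BV Vx VO]] := Bbase x O (open_nbhs_nbhs (conj oO Ox)).
exists (s V); split; last by exists V.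
by apply: VO; apply: sP; exists x; exact: Vx.
Qed.

Definition compact_mmSpace (K : pMetricType R) (cK : compact [set: K])
    (P : probability (borelType K) R) : mmSpace R :=
  MMSpace (compact_complete cK) (compact_separable cK) P.

(** Ensures that describing the metric through fully supported measures reaches every class. *)
Lemma isoClass_full_support C :
  exists2 X : mmSpace R, iso_class C X & full_support X.
Proof.
have cK := @isoClass_repr_compact C.
have [A cA dA] := compact_separable cK.
have [a aP] := countable_dense_sequence cA dA.
have [P PT] := full_support_probability aP.
by exists (compact_mmSpace cK P) => //; exact: isoClass_reprP.
Qed.

End IsometryClasses.

(* The carrier must be in Set: PointedMetric lives in a smaller universe than
   pointedType, hence the explicit base point. *)
Definition discrete_metric (R : realType) (T : Set) (t0 : T) : Set := T.

(** * Discrete metric spaces *)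

Section DiscreteMetric.
Context {R : realType} {T : Set} {t0 : T}.
Local Notation D := (discrete_metric R t0).

HB.instance Definition _ := gen_eqMixin D.
HB.instance Definition _ := gen_choiceMixin D.
HB.instance Definition _ := isPointed.Build D t0.

Let dist (x y : D) : R := (x != y)%:R.

Let distxx x : dist x x = 0.
Proof. by rewrite /dist eqxx. Qed.

Let dist_positivity x y : dist x y = 0 -> x = y.
Proof. by rewrite /dist; case: eqVneq => // _ /eqP; rewrite oner_eq0. Qed.

Let dist_sym x y : dist x y = dist y x.
Proof. by rewrite /dist eq_sym. Qed.

Let dist_triangle y x z : dist x z <= dist x y + dist y z.
Proof.
rewrite /dist; have [->|xy] := eqVneq x y; first by rewrite add0r.
by apply: (@le_trans _ _ 1); [case: (x != z)|rewrite lerDl].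
Qed.

HB.instance Definition _ := isMetric.Build R D
  distxx dist_positivity dist_sym dist_triangle.

End DiscreteMetric.

(** * Finite exponents: failure of the triangle inequality *)

Section FiniteExponent.
Context {R : realType}.
Local Notation D t := (discrete_metric R t).

Lemma discrete_mdistE (T : Set) (t : T) (x y : D t) :
  mdist x y = (x != y)%:R :> R.
Proof. by []. Qed.

(** Unit balls are singletons, so every set is open. *)
Lemma discrete_borel (T : Set) (t : T) (A : set (D t)) :
  measurable (A : set (borelType (D t))).
Proof.
apply: open_borel_measurable; rewrite openE => x Ax; apply/nbhs_ballP.
exists 1 => //= y; rewrite ballEmdist /= discrete_mdistE.
by case: eqVneq => [<-//|_]; rewrite ltxx.
Qed.

Lemma discrete_prod_borel (S T : Set) (s : S) (t : T) (A : set (D s * D t)) :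
  measurable (A : set (borelType (D s * D t)%type)).
Proof.
apply: open_borel_measurable; rewrite openE => -[x y] Axy; apply/nbhs_ballP.
exists 1 => //= -[x' y'] []; rewrite !ballEmdist /= !discrete_mdistE.
by case: eqVneq => [<-|_]; case: eqVneq => [<-|_]; rewrite ?ltxx.
Qed.

Lemma discrete_compact (T : Set) (t : T) :
  finite_set [set: T] -> compact [set: D t].
Proof. by move=> fT; apply: finite_compact; exact: fT. Qed.

Definition discrete_mmSpace (T : Set) (t : T) (fT : finite_set [set: T])
    (P : probability (borelType (D t)) R) : mmSpace R :=
  @compact_mmSpace R (D t) (@discrete_compact _ t fT) P.

Lemma full_support_discrete (T : Set) (t : T) (fT : finite_set [set: T])
    (P : probability (borelType (D t)) R) :
  (forall x : D t, (0 < P [set x])%E) ->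
  full_support (@discrete_mmSpace _ t fT P).
Proof.
move=> P0; apply/seteqP; split => // x _ U oU Ux; apply: lt_le_trans (P0 x) _.
by apply: le_measure => [||_ ->//]; apply: mem_set; exact: discrete_borel.
Qed.

Lemma discrete_graph_coupling (S T : Set) (s : S) (t : T)
    (P : probability (borelType (D s)) R) (f : D s -> D t) :
  exists2 gamma : probability (borelType (D s * D t)%type) R,
    @semi_coupling R (D s) (D t) P gamma &
    forall A, gamma A = P ((fun x => (x, f x)) @^-1` A).
Proof.
have [|gamma gE] := @pushforward_probability _ _ _ _
    (borelType (D s * D t)%type) P (fun x => (x, f x)).
  by apply: measurable_fun_borel => U _; exact: discrete_borel.
exists gamma => // A mA; rewrite gE; congr (P _).
by apply/seteqP; split => x //= [].
Qed.

(** The coupling carried by the graph of an isometric embedding has zero discrepancy almost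
    everywhere. *)
Lemma d_srGW_discrete_embedding (S T : Set) (s : S) (t : T)
    (fS : finite_set [set: S]) (fT : finite_set [set: T])
    (P : probability (borelType (D s)) R)
    (Q : probability (borelType (D t)) R) (f : D s -> D t) (p : R) :
  0 < p -> (forall x x', mdist (f x) (f x') = mdist x x' :> R) ->
  (d_srGW p%:E (@discrete_mmSpace _ s fS P)
     (@discrete_mmSpace _ t fT Q) <= 0)%E.
Proof.
move=> p0 fiso.
have [gamma scg gE] := discrete_graph_coupling P f.
apply: ge_ereal_inf; exists (measure_distortion p%:E gamma).
  by exists gamma.
pose G : set (D s * D t) := [set z | z.2 = f z.1].
have g0 (h : D s * D t -> \bar R) : (forall z, G z -> h z = 0%E) ->
    (\int[gamma]_z h z = 0)%E.
  move=> hG; rewrite -[RHS](integral0 gamma setT); apply: ae_eq_integral => //.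
  - by move=> _ B _; exact: discrete_prod_borel.
  - exists (~` G); split; first exact: discrete_prod_borel.
      apply: etrans (gE _) _; rewrite (_ : _ @^-1` _ = set0) ?measure0//.
      by apply/seteqP; split => // x /=; apply.
    by move=> z /= nz Gz; apply: nz => _; exact: hG.
rewrite /= g0 ?poweRE.
  by rewrite invr_eq0 gt_eqF//= powR0 ?mule0// invr_neq0// gt_eqF.
move=> z Gz; apply: g0 => z' Gz'.
by rewrite /discrepancy Gz Gz' fiso subrr normr0 powR0// gt_eqF.
Qed.

Lemma discrepancy_point (S : Set) (s : S) (z z' : D s * D tt) :
  discrepancy z z' = (z.1 != z'.1)%:R :> R.
Proof.
rewrite /discrepancy !discrete_mdistE; case: z z' => [x []] [x' []] /=.
by rewrite eqxx subr0 ger0_norm.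
Qed.

Lemma biased_coin (a : R) : 0 <= a <= 1 ->
  exists P : probability (borelType (D true)) R,
    P [set true] = a%:E /\ P [set false] = (1 - a)%:E.
Proof.
move=> a01.
have [|P PE] := @pushforward_probability R _ _ _ (borelType (D true))
  (bernoulli_prob a) (id : bool -> D true).
  by apply: measurable_fun_borel => U oU.
have {}PE (A : set bool) : P A = bernoulli_prob a A by exact: PE.
exists P; rewrite !PE !bernoulli_probE// !diracE.
have mem1 (b c : bool) : (b \in [set c]%classic) = (b == c) 
  by apply/idP/eqP => [/set_mem|->] //; exact: mem_set.
by rewrite !mem1 /= !mule1 !mule0 adde0 add0e.
Qed.

(** The [p]-th power of the discrepancy is the indicator that two independent tosses differ, an
    event of probability [2 * (a * (1 - a))]. Hence all semi-couplings with the one-point space have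
    the same distortion. *)
Lemma two_point_distortion (a p : R)
    (P : probability (borelType (D true)) R)
    (gamma : probability (borelType (D true * D tt)%type) R) : 0 < p ->
  P [set true] = a%:E -> P [set false] = (1 - a)%:E ->
  @semi_coupling R (D true) (D tt) P gamma ->
  measure_distortion p%:E gamma = (2^-1 * (2 * (a * (1 - a))) `^ p^-1)%:E.
Proof.
move=> p0 Pt Pf scg.
have gE (b : D true) : gamma [set z | z.1 = b] = P [set b].
  rewrite -scg; last exact: discrete_borel.
  by congr (gamma _); apply/seteqP; split => z /=; [|case].
have a0 : 0 <= a by rewrite -lee_fin -Pt.
have a1 : 0 <= 1 - a by rewrite -lee_fin -Pf.
(* The mass of the point other than [b]. *)
pose c (b : D true) : R := if b then 1 - a else a.
have inner z : (\int[gamma]_z' (discrepancy z z' `^ p)%:E = (c z.1)%:E)%E.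
  pose other := [set w : D true * D tt | w.1 = ~~ z.1].
  transitivity (\int[gamma]_z' (\1_other z')%:E)%E.
    apply: eq_integral => z' _; rewrite discrepancy_point indicE.
    have [zz'|zz'] := eqVneq z.1 z'.1.
      by rewrite powR0 ?gt_eqF// memNset ?/other//= -zz'; case: (z.1).
    rewrite powR1 mem_set// /other /=; move/eqP: zz'.
    by case: (z.1); case: (z'.1).
  rewrite integral_indic//; last exact: discrete_prod_borel.
  by rewrite setIT; apply: etrans (gE _) _; rewrite /c; case: (z.1).
rewrite /=; under eq_integral do rewrite inner.
have -> : (\int[gamma]_z (c z.1)%:E = (2 * (a * (1 - a)))%:E)%E.
  have TT : [set: D true * D tt] =
      [set z | z.1 = true] `|` [set z | z.1 = false].
    by apply/seteqP; split => // -[[] u] _; [left|right].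
  rewrite TT ge0_integral_setU//.
  - rewrite (eq_integral (cst (1 - a)%:E)); last by move=> z /set_mem /= ->.
    rewrite [in X in (_ + X)%E](eq_integral (cst a%:E)); last first.
      by move=> z /set_mem /= ->.
    rewrite !integral_cst//; [|exact: discrete_prod_borel..].
    rewrite [X in (_ * X + _)%E]gE [X in (_ + _ * X)%E]gE Pt Pf.
    by rewrite -!EFinM -EFinD; congr (_%:E); lra.
  - exact: discrete_prod_borel.
  - exact: discrete_prod_borel.
  - by move=> _ B _; exact: discrete_prod_borel.
  - by move=> z _; rewrite lee_fin /c; case: (z.1).
  - by apply/disj_setPS => z [/= ->].
by rewrite poweR_EFin -EFinM.
Qed.

Lemma hd_srGW_not_pseudometric (p : R) : 1 <= p ->
  ~ is_pseudometric [set X : mmSpace R | compact [set: X] /\ full_support X]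
      (hd_srGW p%:E).
Proof.
move=> p1; have p0 : 0 < p by lra.
have fbool : finite_set [set: bool] by exact: finite_finset.
have funit : finite_set [set: unit] by exact: finite_finset.
have [|P2 [P2t P2f]] := @biased_coin (1 / 2); first by lra.
have [|P4 [P4t P4f]] := @biased_coin (1 / 4); first by lra.
pose X := @discrete_mmSpace _ true fbool P2.
pose Y := @discrete_mmSpace _ true fbool P4.
pose Z := @discrete_mmSpace _ tt funit (dirac (tt : borelType (D tt))).
have in_bool (P : probability (borelType (D true)) R) :
    (0 < P [set true])%E -> (0 < P [set false])%E ->
    full_support (discrete_mmSpace fbool P).
  by move=> Pt Pf; apply: full_support_discrete => -[].
have FX : compact [set: X] /\ full_support X.
  split; first exact: discrete_compact.
  by apply: in_bool; rewrite ?P2t ?P2f lte_fin; lra.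
have FY : compact [set: Y] /\ full_support Y.
  split; first exact: discrete_compact.
  by apply: in_bool; rewrite ?P4t ?P4f lte_fin; lra.
have FZ : compact [set: Z] /\ full_support Z.
  split; first exact: discrete_compact.
  by apply: full_support_discrete => -[]; rewrite /= diracE mem_set// lte01.
case=> _ _ _ /(_ X Y Z FX FY FZ).
apply/negP; rewrite -ltNge.
(* The distortion of a coin of bias [a] against the point; it is larger at 1/2 than at 1/4 because
   [a * (1 - a)] is 1/4 against 3/16. *)
pose v (a : R) := 2^-1 * (2 * (a * (1 - a))) `^ p^-1.
have v_lt : v (1 / 4) < v (1 / 2).
  rewrite /v ltr_pM2l//; apply: gt0_ltr_powR; rewrite ?invr_gt0 ?nnegrE; lra.
have XY0 : (hd_srGW p%:E X Y <= 0)%E.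
  by rewrite ge_max !(@d_srGW_discrete_embedding _ _ _ _ _ _ _ _ id).
have YZ : (hd_srGW p%:E Y Z <= (v (1 / 4))%:E)%E.
  rewrite ge_max; apply/andP; split.
    have [gamma scg _] := discrete_graph_coupling P4 (fun=> tt : D tt).
    apply: ge_ereal_inf; exists (measure_distortion p%:E gamma).
      by exists gamma.
    by rewrite (two_point_distortion p0 P4t P4f scg).
  (* From the point to [Y] any map is an isometric embedding, so this direction contributes 0. *)
  apply: le_trans (_ : (0 <= _)%E); last by rewrite lee_fin mulr_ge0// powR_ge0.
  apply: (@d_srGW_discrete_embedding _ _ _ _ _ _ _ _ (fun=> true)) => // -[] [].
  by rewrite !mdistxx.
have XZ : ((v (1 / 2))%:E <= hd_srGW p%:E X Z)%E.
  rewrite le_max; apply/orP; left; apply: le_ereal_inf_tmp => _ [gamma scg <-].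
  by rewrite (two_point_distortion p0 P2t P2f scg).
(* The detour from [X] to [Z] through [Y] costs at most [v (1 / 4)], strictly less than the direct
   distance. *)
apply: lt_le_trans XZ; apply: le_lt_trans (_ : (0 + (v (1 / 4))%:E < _)%E).
  exact: leeD.
by rewrite add0e lte_fin.
Qed.

End FiniteExponent.

Theorem theorem9 (R : realType) :
  (forall X Y : mmSpace R, full_support X ->
     [/\ d_srGW +oo%E X Y = d_srGH X Y,
         full_support Y -> hd_srGW +oo%E X Y = hd_srGH X Y &
         hd_srGH X Y = d_mGH X Y]) /\
  (exists D : isoClass R -> isoClass R -> \bar R,
     [/\ forall C : isoClass R, exists2 X : mmSpace R, iso_class C X & full_support X,
         forall (C C' : isoClass R) (X Y : mmSpace R), iso_class C X -> iso_class C' Y ->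
           full_support X -> full_support Y -> D C C' = hd_srGW +oo%E X Y,
         is_metric D &
         forall F : set (isoClass R), precompact_family d_GH_class F ->
           topologically_equivalent_on F D d_GH_class]) /\
  (forall p : R, 1 <= p ->
     ~ is_pseudometric
         [set X : mmSpace R | compact [set: X] /\ full_support X]
         (hd_srGW p%:E)).
Proof.
have hd_eq (X Y : mmSpace R) : full_support X -> full_support Y ->
    hd_srGW +oo%E X Y = hd_srGH X Y.
  by move=> fX fY; rewrite /hd_srGW !d_srGW_infty.
split; [|split].
- move=> X Y fX; split; [exact: d_srGW_infty|exact: hd_eq|exact: hd_srGHE].
- exists hd_srGH_class; split.
  + exact: isoClass_full_support.
  + move=> C C' X Y CX C'Y fX fY.
    by rewrite hd_eq//; exact: hd_srGH_classE.
  + exact: hd_srGH_class_metric.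
  + exact: hd_srGH_class_topology.
- exact: hd_srGW_not_pseudometric.
Qed.
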